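(* Let $m \ge 1$ and $k = 2m+3$. A connected graph $G$ is an $SC_k$ graph if and only if, in its decomposition along clique separators of size one and two, every piece is either a single edge ($K_2$, arising as a cut edge) or a cycle $C_k$.
   Context: All graphs are finite, simple and undirected. A graph $G$ is an $SC_k$ graph if either $G$ has no cycle, or every induced cycle of $G$ has length exactly $k$. The decomposition of $G$ along clique separators of size one and two is obtained as follows: first split $G$ into its bi-connected components (maximal subgraphs with no cut vertex; a cut edge forms its own component $K_2$); then, repeatedly, whenever a piece $H$ contains an edge $\{u,v\}$ such that $H-\{u,v\}$ is disconnected, replace $H$ by the graphs induced on $C\cup\{u,v\}$ for each connected component $C$ of $H-\{u,v\}$ (so the edge $\{u,v\}$ is kept in each new piece); stop when no piece has such a cut vertex or separating edge. *)

(* Defs.v *)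
From mathcomp Require Import all_boot.
Set Implicit Arguments.
Unset Strict Implicit.
Unset Printing Implicit Defensive.

(* A graph is a finType T of vertices with a symmetric irreflexive adjacency
   relation e; an induced subgraph is represented by its vertex set A. *)
Section Graphs.
Variables (T : finType) (e : rel T).
Implicit Types (A C H : {set T}) (P Q : {set {set T}}) (c : seq T).

Definition induced A : rel T := [rel x y | [&& x \in A, y \in A & e x y]].

(* The empty set counts as connected; this matters for the deletion of a vertex
   or of an edge, where "disconnected" must mean at least two components. *)
Definition gconnected A : bool :=
  [forall x in A, forall y in A, connect (induced A) x y].

Definition components A : {set {set T}} :=
  equivalence_partition (connect (induced A)) A.

Definition is_cycle c : bool := (2 < size c) && ucycleb e c.

Definition is_induced_cycle c : bool :=
  is_cycle c &&
  all (fun x => all (fun y => e x y ==> (y == next c x) || (x == next c y)) c) c.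

Definition SC (k : nat) : Prop :=
  (forall c, ~~ is_cycle c) \/ (forall c, is_induced_cycle c -> size c = k).

Definition cut_vertex A (v : T) : bool := (v \in A) && ~~ gconnected (A :\ v).

Definition biconnected A : bool :=
  gconnected A && [forall v, ~~ cut_vertex A v].

(* A bi-connected component has at least one edge (equivalently, two vertices):
   the blocks decompose the edges of the graph, so that the one-vertex graph has
   no block.  For a connected graph on at least two vertices the requirement
   1 < #|A| is redundant. *)
Definition block A : bool :=
  maxset [pred B : {set T} | (1 < #|B|) && biconnected B] A.

Definition blocks : {set {set T}} := [set A | block A].

Definition separating_edge H (u v : T) : bool :=
  [&& u \in H, v \in H, e u v & ~~ gconnected (H :\: [set u; v])].

Definition split_along H (u v : T) : {set {set T}} :=
  [set C :|: [set u; v] | C in components (H :\: [set u; v])].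

Definition split_step P Q : bool :=
  [exists H in P, exists u, exists v,
     separating_edge H u v && (Q == (P :\ H) :|: split_along H u v)].

Definition fully_split P : bool :=
  [forall H in P, [forall v, ~~ cut_vertex H v] &&
                  [forall u, forall v, ~~ separating_edge H u v]].

(* P is a final outcome of the splitting process, for some choice of the
   separating edges along the way. *)
Definition clique_decomposition P : bool :=
  connect split_step blocks P && fully_split P.

Definition is_K2 A : Prop := exists u v, e u v /\ A = [set u; v].

Definition is_Ck (k : nat) A : Prop :=
  exists c, [/\ is_induced_cycle c, size c = k & A = [set x in c]].

End Graphs.

Section Existence.
Variables (T : finType) (e : rel T).
Hypothesis e_sym : symmetric e.
Implicit Types (A C H : {set T}) (P Q : {set {set T}}).

Lemma induced_sym A : connect_sym (induced e A).
Proof.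
by apply: sym_connect_sym => x y; rewrite /induced /= e_sym andbCA.
Qed.

Lemma component_mem H C x y : C \in components e H -> x \in C ->
  y \in C = (y \in H) && connect (induced e H) x y.
Proof.
case/imsetP=> z zH ->; rewrite !inE => /andP[xH zx]; congr (_ && _).
by apply: (same_connect (induced_sym H)).
Qed.

Lemma componentS H C : C \in components e H -> C \subset H.
Proof. by case/imsetP=> z zH ->; apply/subsetP=> x; rewrite inE => /andP[]. Qed.

Lemma reach_edge H u v C w x y p :
  C \in components e (H :\: [set u; v]) -> x \in C -> x != w ->
  path (induced e (H :\ w)) x p -> y = last x p -> y \in [set u; v] ->
  exists2 z, z \in [set u; v] :\ w &
    connect (induced e ((C :|: [set u; v]) :\ w)) x z.
Proof.
move=> CH; elim: p x => [|a p IHp] x xC xw /=.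
  by move=> _ ->; have /subsetP/(_ _ xC) := componentS CH; rewrite inE => /andP[/negP].
case/andP=> /and3P[] /setD1P[_ xH] /setD1P[aw aH] xa pp yl yuv.
have xuv : x \notin [set u; v].
  by have /subsetP/(_ _ xC) := componentS CH; rewrite inE => /andP[].
have stp : a \in C :|: [set u; v] ->
    connect (induced e ((C :|: [set u; v]) :\ w)) x a.
  move=> aA; apply: connect1; apply/and3P; split=> //; rewrite in_setD1 ?xw ?aw //=.
  by rewrite in_setU xC.
case: (boolP (a \in [set u; v])) => auv.
  by exists a; [rewrite in_setD1 aw | apply: stp; rewrite in_setU auv orbT].
have aC : a \in C.
  rewrite (component_mem _ CH xC) in_setD auv aH /=.
  by apply: connect1; rewrite /induced /= !in_setD xuv auv xH aH.
have [z zuv az] := IHp a aC aw pp yl yuv.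
by exists z => //; apply: connect_trans az; apply: stp; rewrite in_setU aC.
Qed.

Lemma split_no_cut H u v C w : u != v ->
  [forall w, ~~ cut_vertex e H w] -> separating_edge e H u v ->
  C \in components e (H :\: [set u; v]) -> ~~ cut_vertex e (C :|: [set u; v]) w.
Proof.
move=> uv ncut /and4P[uH vH euv _] CH; apply/negP => /andP[wA /negP]; apply.
have CHs := componentS CH.
have wH : w \in H.
  move: wA; rewrite !inE => /orP[/(subsetP CHs)|/orP[]/eqP-> //].
  by rewrite inE => /andP[].
have Hw : gconnected e (H :\ w).
  by move/forallP: ncut => /(_ w); rewrite /cut_vertex wH negbK.
set A := C :|: [set u; v].
have uvw z1 z2 : z1 \in [set u; v] :\ w -> z2 \in [set u; v] :\ w ->
    connect (induced e (A :\ w)) z1 z2.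
  case: (eqVneq z1 z2) => [-> //|z12] z1w z2w; apply: connect1.
  have sub z : z \in [set u; v] :\ w -> z \in A :\ w.
    by rewrite !inE => /andP[-> ->]; rewrite orbT.
  rewrite /induced /= !sub //=.
  move: z12 z1w z2w; rewrite !inE => z12 /andP[_ z1uv] /andP[_ z2uv].
  case/orP: z1uv z12 => /eqP->; case/orP: z2uv => /eqP->; rewrite ?eqxx //.
  by rewrite e_sym.
have ex x : x \in A :\ w -> exists2 z, z \in [set u; v] :\ w &
    connect (induced e (A :\ w)) x z.
  rewrite in_setD1 in_setU => /andP[xw /orP[xC|xuv]]; last first.
    by exists x => //; rewrite in_setD1 xw.
  have [y yuv yw] : exists2 y, y \in [set u; v] & y != w.
    case: (eqVneq u w) => [<-|]; last by exists u => //; rewrite !inE eqxx.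
    by exists v; rewrite ?(eq_sym v) // !inE eqxx orbT.
  have xH : x \in H by move/(subsetP CHs): xC; rewrite inE => /andP[].
  have yH : y \in H by move: yuv; rewrite !inE => /orP[]/eqP->.
  have /connectP[p pp yl] : connect (induced e (H :\ w)) x y.
    move/forall_inP: Hw => /(_ x); rewrite in_setD1 xw xH => /(_ isT).
    by move/forall_inP; apply; rewrite in_setD1 yw.
  exact: (reach_edge CH xC xw pp yl yuv).
apply/forall_inP => x /ex[z1 z1w xz1]; apply/forall_inP => y /ex[z2 z2w yz2].
apply: connect_trans xz1 _; apply: connect_trans (uvw _ _ z1w z2w) _.
by rewrite induced_sym.
Qed.

Lemma split_proper H u v A : separating_edge e H u v ->
  A \in split_along e H u v -> #|A| < #|H|.
Proof.
case/and4P=> uH vH _ disc /imsetP[C CH ->]; apply: proper_card.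
rewrite properE; apply/andP; split.
  apply/subsetP=> x; rewrite !inE => /orP[/(subsetP (componentS CH))|].
    by rewrite inE => /andP[].
  by case/orP=> /eqP->.
apply: contra disc => /subsetP HC; apply/forall_inP => x xH.
have inC z : z \in H :\: [set u; v] -> z \in C.
  by rewrite in_setD => /andP[zuv /HC]; rewrite in_setU (negPf zuv) orbF.
apply/forall_inP => y /inC; rewrite (component_mem _ CH (inC _ xH)).
by case/andP.
Qed.

Lemma clique_decomposition_exists :
  irreflexive e -> exists P, clique_decomposition e P.
Proof.
move=> e_irr; pose N := #|T|.+1.
have Hb : [forall H in blocks e, forall v, ~~ cut_vertex e H v].
  by apply/forall_inP => H; rewrite inE => /maxsetp /andP[_ /andP[]].
suff: forall n P, \sum_(A in P) N ^ #|A| < n ->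
    [forall H in P, forall v, ~~ cut_vertex e H v] ->
    exists2 Q, connect (split_step e) P Q & fully_split e Q.
  by move=> /(_ _ (blocks e) (leqnn _) Hb)[Q]; exists Q; apply/andP.
elim=> // n IHn P Pn /forall_inP Pcut.
case: (boolP (fully_split e P)) => [|nfull]; first by exists P.
have [H HP [u [v suv]]] : exists2 H, H \in P & exists u v, separating_edge e H u v.
  case/forall_inPn: nfull => H HP; rewrite Pcut //= => /forallPn[u /forallPn[v]].
  by rewrite negbK; exists H => //; exists u, v.
set Q := (P :\ H) :|: split_along e H u v.
have PQ : split_step e P Q.
  by apply/exists_inP; exists H => //; apply/existsP; exists u; apply/existsP;
     exists v; rewrite suv eqxx.
have [||R QR Rf] := IHn Q; last by exists R => //; apply: connect_trans (connect1 PQ) QR.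
- have Hgt0 : 0 < #|H| by case/and4P: suv => uH *; apply/card_gt0P; exists u.
  apply: (@leq_trans (\sum_(A in P) N ^ #|A|)); last by rewrite -ltnS.
  rewrite [ltnRHS](bigD1 H) //= [ltnRHS]addnC.
  have -> : \sum_(A in P | A != H) N ^ #|A| = \sum_(A in P :\ H) N ^ #|A|.
    by apply: eq_bigl => A; rewrite in_setD1 andbC.
  apply: (@leq_ltn_trans (\sum_(A in P :\ H) N ^ #|A| +
                          \sum_(A in split_along e H u v) N ^ #|A|)).
    rewrite /Q (big_setID (P :\ H)) /= setUK setDUl setDv set0U leq_add2l.
    by rewrite [leqRHS](big_setID (P :\ H)) leq_addl.
  rewrite ltn_add2l.
  apply: (@leq_ltn_trans (\sum_(A in split_along e H u v) N ^ #|H|.-1)).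
    apply: leq_sum => A /(split_proper suv) AH.
    by apply: leq_pexp2l => //; rewrite -ltnS prednK.
  rewrite sum_nat_const -{2}(prednK Hgt0) expnS ltn_pmul2r ?expn_gt0 // ltnS.
  apply: leq_trans (leq_imset_card _ _) _.
  by apply: leq_trans (leq_imset_card _ _) _; apply: max_card.
- apply/forall_inP => A; rewrite in_setU => /orP[/setD1P[_ AP]|]; first exact: Pcut.
  case/imsetP=> C CH ->; apply/forallP => w.
  apply: (split_no_cut w _ (Pcut _ HP) suv CH).
  by case/and4P: suv => _ _ euv _; apply: contraTneq euv => ->; rewrite e_irr.
Qed.

End Existence.

(* Main.v *)
Require Import Defs.
From mathcomp Require Import all_boot zify.

(* Every piece H is biconnected without separating edge.  If all induced cycles
   have length k = 2m+3 and |H| > 2, then H contains an induced cycle C of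
   length k.  Suppose H <> C and let D be a component of H - C.  As H has no
   cut vertex, no separating edge and no triangle, D is attached to two distinct
   non-adjacent vertices of C; join two such vertices u, v by an ear through D
   with as few interior vertices r as possible.
   If r = 1, closing the ear along C up to its first and up to its last far
   neighbour gives two cycles of length k, which forces k = 4.  If r > 1, then by
   minimality an interior vertex of the ear other than its ends can only see a
   common neighbour of u and v on C.  If u and v have a common neighbour w on C,
   the ear and the arc avoiding w form an induced cycle of length k - 2 + r + 1 > k;
   otherwise both arcs close up with the ear to induced cycles, so the arcs have
   equal length and k is even.
   Conversely, deleting a clique never disconnects an induced cycle, so each
   induced cycle of the graph survives inside one piece; that piece must be a C_k,
   and an induced cycle inside an induced cycle is all of it. *)

Set Implicit Arguments.
Unset Strict Implicit.
Unset Printing Implicit Defensive.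

Ltac nat_lia := repeat match goal with
  | H : forall _, _ |- _ => clear H
  | H : is_true (?g _ _) |- _ => is_var g; clear H
  | H : is_true (_ \in _) |- _ => clear H
  | H : is_true (_ \notin _) |- _ => clear H
  end; lia.

(** * Induced paths and cycles indexed by position *)

Section InducedCycles.
Variables (T : finType) (e : rel T).
Hypotheses (e_sym : symmetric e) (e_irr : irreflexive e).
Implicit Types (A B C H X : {set T}) (f g : nat -> T).

(** The vertices [f 0], ..., [f n.-1] form, in this order, an induced path. *)
Definition chordless n f := forall i j, i < j < n ->
  f i != f j /\ e (f i) (f j) = (j == i.+1).

(* f 0, ..., f n.-1 is, in this cyclic order, an induced cycle; values of f beyond
   n are irrelevant. *)
Definition icyc n f := 2 < n /\ forall i j, i < j < n ->
  f i != f j /\ e (f i) (f j) = (j == i.+1) || (i == 0) && (j == n.-1).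

Definition cset n f : {set T} := [set f i | i : 'I_n].

Lemma csetP n f x : reflect (exists2 i, i < n & x = f i) (x \in cset n f).
Proof.
apply: (iffP imsetP) => [[i _ ->]|[i lt_in ->]]; first by exists i.
by exists (Ordinal lt_in).
Qed.

Lemma mem_cset n f i : i < n -> f i \in cset n f.
Proof. by move=> lt_in; apply/csetP; exists i. Qed.

Lemma icyc_inj n f i j : icyc n f -> i < n -> j < n -> f i = f j -> i = j.
Proof.
move=> [_ cf] lt_in lt_jn eq_f; case: (ltngtP i j) => // ltij.
  by case: (cf i j); rewrite ?ltij ?eq_f ?eqxx.
by case: (cf j i); rewrite ?ltij ?eq_f ?eqxx.
Qed.

Lemma card_cset n f : icyc n f -> #|cset n f| = n.
Proof.
move=> cf; rewrite card_imset ?card_ord // => i j /(icyc_inj cf) eq_ij.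
by apply/val_inj/eq_ij.
Qed.

Lemma icyc_rot n f t : icyc n f -> t < n ->
  exists g, [/\ icyc n g, g 0 = f t & cset n g = cset n f].
Proof.
move=> cf lt_tn; have [n2 cf'] := cf.
exists (fun i => f (if i + t < n then i + t else i + t - n)); split.
- split=> // i j ltij.
  case: ifP => hi; case: ifP => hj; try lia.
  + have [|-> ->] := cf' (i + t) (j + t); first lia.
    by split => //; lia.
  + have [|H1 H2] := cf' (j + t - n) (i + t); first lia.
    by rewrite eq_sym H1 e_sym H2; split => //; lia.
  + have [|-> ->] := cf' (i + t - n) (j + t - n); first lia.
    by split => //; lia.
- by rewrite add0n lt_tn.
- apply/setP => x; apply/csetP/csetP => [[i lt_in ->]|[i lt_in ->]].
    by exists (if i + t < n then i + t else i + t - n) => //; case: ifP; lia.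
  exists (if t <= i then i - t else i + n - t); first by case: ifP; lia.
  by congr f; case: (leqP t i) => ?; case: ifP; lia.
Qed.

(** The cycle traversed backwards from [f 0]; position 0 is treated apart because the value [f n] is
    meaningless. *)
Definition flip n f i := if i == 0 then f 0 else f (n - i).

Lemma icyc_flip n f : icyc n f -> icyc n (flip n f).
Proof.
move=> [n2 cf]; split=> // i j ltij; rewrite /flip.
have -> : (j == 0) = false by lia.
case: (eqVneq i 0) => [i0|ni].
  have [|-> ->] := cf 0 (n - j); first lia.
  by split => //; lia.
have [|H1 H2] := cf (n - j) (n - i); first lia.
by rewrite eq_sym H1 e_sym H2; split => //; lia.
Qed.

Lemma icyc_next n f i : icyc n f -> i.+1 < n -> e (f i) (f i.+1).
Proof. by move=> [_ cf] lt_in; have [|_ ->] := cf i i.+1; lia. Qed.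

Lemma icyc_nbrs n f x : icyc n f -> x \in cset n f ->
  exists y z, [/\ y \in cset n f, z \in cset n f, y != z, e x y & e x z].
Proof.
move=> cf /csetP[t lt_tn ->]; have [g [[n2 cg] <- <-]] := icyc_rot cf lt_tn.
exists (g 1), (g n.-1); rewrite !mem_cset; try lia.
have [|_ ->] := cg 0 1; first lia.
have [|_ ->] := cg 0 n.-1; first lia.
have [|-> _] := cg 1 n.-1; first lia.
by split=> //; lia.
Qed.

Lemma icyc_seq n f : icyc n f -> is_induced_cycle e (mkseq f n).
Proof.
move=> cf; have [n2 cf'] := cf.
have inj : uniq (mkseq f n).
  by apply/mkseq_uniqP => i j; rewrite !inE => *; apply: (icyc_inj cf).
have nxt i : i < n -> next (mkseq f n) (f i) = f (if i.+1 < n then i.+1 else 0).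
  move=> lt_in; rewrite next_nth map_f ?mem_iota //.
  have -> : index (f i) (mkseq f n) = i.
    by rewrite -{1}(@nth_mkseq _ (f 0) f n i) // index_uniq ?size_mkseq.
  case: n n2 lt_in {cf cf' inj} => // n _ lt_in /=.
  case: ifP => hi; last by rewrite nth_default // size_map size_iota; lia.
  by rewrite (nth_map 0) ?size_iota ?nth_iota //; lia.
have adj i : i < n -> e (f i) (f (if i.+1 < n then i.+1 else 0)).
  move=> lt_in; case: ifP => hi; first by have [|_ ->] := cf' i i.+1; lia.
  by rewrite e_sym; have [|_ ->] := cf' 0 i; lia.
apply/andP; split.
  rewrite /is_cycle size_mkseq n2 /ucycleb inj andbT.
  apply: cycle_from_next => // x /mapP[i]; rewrite mem_iota => lt_in ->.
  by rewrite nxt ?adj //.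
apply/allP => x /mapP[i]; rewrite mem_iota => /= lt_in ->.
apply/allP => y /mapP[j]; rewrite mem_iota => /= lt_jn ->.
apply/implyP; rewrite !nxt //.
case: (ltngtP i j) => [ltij|ltji|->]; last by rewrite e_irr.
- have [|_ ->] := cf' i j; first lia.
  case/orP => [/eqP Dj|/andP[/eqP Di /eqP Dj]].
    by rewrite -Dj lt_jn eqxx.
  have -> : (j.+1 < n) = false by lia.
  by rewrite Di eqxx orbT.
- rewrite e_sym; have [|_ ->] := cf' j i; first lia.
  case/orP => [/eqP Di|/andP[/eqP Dj /eqP Di]].
    by rewrite -Di lt_in eqxx orbT.
  have -> : (i.+1 < n) = false by lia.
  by rewrite Dj eqxx.
Qed.

Lemma seq_icyc x0 c : is_induced_cycle e c -> icyc (size c) (nth x0 c).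
Proof.
case/andP => /andP[n2 /andP[cyc unq]] /allP chord; split=> // i j /andP[ltij ltj].
have lti := ltn_trans ltij ltj.
have nxt l : l < size c -> next c (nth x0 c l) = nth x0 c (if l.+1 < size c then l.+1 else 0).
  move=> ltl; rewrite next_nth mem_nth // index_uniq //.
  case: c {n2 cyc unq chord ltj lti} ltl => // y p /= ltl.
  by case: ifP => hl; [apply: set_nth_default | rewrite nth_default //]; lia.
have adj l : l < size c -> e (nth x0 c l) (nth x0 c (if l.+1 < size c then l.+1 else 0)).
  by move=> ltl; rewrite -nxt // next_cycle // mem_nth.
split; first by rewrite nth_uniq //; lia.
apply/idP/orP => [eij|[/eqP D0|/andP[/eqP -> /eqP Dj]]].
- have /allP/(_ _ (mem_nth x0 ltj)) := chord _ (mem_nth x0 lti).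
  have bnd l : (if l.+1 < size c then l.+1 else 0) < size c by case: ifP => //; lia.
  rewrite eij !nxt // !nth_uniq //.
  by case: ifP; case: ifP => /=; lia.
- by have := adj i lti; rewrite -D0 ltj.
- by rewrite e_sym; have := adj j ltj; case: ifP => //; lia.
Qed.

(** * Minimal walks and the induced cycles they give *)

Lemma shortest_path A (Q : rel T) x y :
  x \in A -> connect (induced e A) x y -> Q x y ->
  exists m g, [/\ Q (g 0) (g m), forall i, i <= m -> g i \in A, chordless m.+1 g &
    forall i j, i <= j <= m -> Q (g i) (g j) -> i = 0 /\ j = m].
Proof.
move=> xA /connectP[p pth ->] Qxy.
(* [P n] asks for a walk of [n] edges in [A] whose ends are related by [Q]; they need not be [x] and
   [y]. In a walk of least length a repetition or a chord would be a shortcut, and a proper subwalk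
   with ends related by [Q] would be shorter. *)
pose P n := [exists a in A, [exists t : n.-tuple T,
  path (induced e A) a t && Q a (last a t)]].
have walkP n h : h 0 \in A -> (forall i, i < n -> induced e A (h i) (h i.+1)) ->
    Q (h 0) (h n) -> P n.
  move=> h0 hS Qh; apply/exists_inP; exists (h 0) => //; apply/existsP.
  have szt : size (mkseq (h \o succn) n) == n by rewrite size_mkseq.
  exists (Tuple szt); have nthh i : i < n.+1 -> nth (h 0) (h 0 :: mkseq (h \o succn) n) i = h i.
    by case: i => // i ltin; rewrite /= nth_mkseq.
  apply/andP; split; last by rewrite (last_nth (h 0)) size_mkseq nthh.
  apply/(pathP (h 0)) => i; rewrite size_mkseq => ltin.
  by rewrite nthh ?nth_mkseq //=; [apply: hS | nat_lia].
have exP : exists n, P n.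
  exists (size p); apply/exists_inP; exists x => //; apply/existsP.
  by exists (in_tuple p); rewrite pth.
case: (ex_minnP exP) => m /exists_inP[a aA /existsP[t /andP[ptht Qt]]] minm.
pose g := nth a (a :: t).
have gS i : i < m -> induced e A (g i) (g i.+1).
  by move=> ltim; move/(pathP a): ptht => /(_ i); rewrite size_tuple => /(_ ltim).
have gm : Q (g 0) (g m) by move: Qt; rewrite (last_nth a) size_tuple.
have gA i : i <= m -> g i \in A.
  by case: i => // i /gS /and3P[].
have shortcut i d : i + d <= m -> 0 < d ->
    g (i + d) = g i \/ (1 < d /\ e (g i) (g (i + d))) -> False.
  move=> led d0 H.
  (* The [d] edges from [g i] to [g (i + d)] are replaced by [k] edges: none at a repetition, one at
     a chord. *)
  have [k [ltk hk]] : exists k, k < d /\ (k = 0 /\ g (i + d) = g i \/ k = 1 /\ e (g i) (g (i + d))).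
    by case: H => [eqg|[d1 eg]]; [exists 0 | exists 1]; split => //; [left | right].
  pose h l := if l <= i then g l else g (l + d - k).
  have := minm (m + k - d); suff -> : P (m + k - d) by move/(_ isT); nat_lia.
  apply: (walkP _ h).
  - by rewrite /h; apply: gA; nat_lia.
  - move=> l ltl; rewrite /h; case: (ltngtP l i) => li.
    + by apply: gS; nat_lia.
    + have -> : l.+1 + d - k = (l + d - k).+1 by nat_lia.
      by apply: gS; nat_lia.
    + subst l; case: hk => -[Dk hk]; subst k.
        have -> : i.+1 + d - 0 = (i + d).+1 by nat_lia.
        by rewrite -hk; apply: gS; nat_lia.
      have -> : i.+1 + d - 1 = i + d by nat_lia.
      by apply/and3P; split=> //; apply: gA; nat_lia.
  - rewrite /h leq0n; case: ifP => hm.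
      have Dk : m = i + d by nat_lia.
      case: hk => -[Dk' hk]; last by nat_lia.
      have -> : m + k - d = i by nat_lia.
      by rewrite -hk -Dk.
    by have -> : m + k - d + d - k = m by nat_lia.
exists m, g; split=> //.
- move=> i j ltij; have Dj : j = i + (j - i) by nat_lia.
  split; first by apply/eqP => eqg; apply: (shortcut i (j - i)); try left; rewrite -?Dj //; nat_lia.
  apply/idP/eqP => [eij|->];
    last by have /and3P[] : induced e A (g i) (g i.+1) by apply: gS; nat_lia.
  case: (eqVneq j i.+1) => // nj; case: (shortcut i (j - i)); try nat_lia.
  by right; rewrite -Dj; split => //; nat_lia.
- move=> i j leij Qij.
  have := minm (j - i); suff -> : P (j - i) by move/(_ isT); nat_lia.
  apply: (walkP _ (fun l => g (i + l))); first by apply: gA; nat_lia.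
    by move=> l ltl; rewrite addnS; apply: gS; nat_lia.
  by rewrite addn0 subnKC //; nat_lia.
Qed.

Lemma gconnectedP A : reflect {in A &, forall x y, connect (induced e A) x y} (gconnected e A).
Proof.
apply: (iffP forall_inP) => conA x; last by move=> xA; apply/forall_inP => y; apply: conA.
by move=> y xA; apply/forall_inP/conA.
Qed.

(** A path from [z] to [c] avoiding [X] is followed until it first enters [C]: [w] is the entry
    point and [d] the vertex before it. *)
Lemma gconnected_exit H C X z c :
  gconnected e (H :\: X) -> X \subset C -> z \in H :\: C -> c \in (H :&: C) :\: X ->
  exists d w, [/\ d \in H :\: C, w \in C :\: X, connect (induced e (H :\: C)) z d & e d w].
Proof.
move=> /gconnectedP conH XC zHC cHC.
have zX : z \in H :\: X.
  by move: zHC; rewrite !inE => /andP[zC ->]; rewrite (contra (subsetP XC z)) .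
have cX : c \in H :\: X by move: cHC; rewrite !inE => /and3P[-> ->].
have cC : c \in C by move: cHC; rewrite !inE => /and3P[].
have /connectP[p] := conH z c zX cX; elim: p z zHC {zX} => [|a p IHp] z zHC /=.
  by move=> _ Dc; move: zHC; rewrite -Dc inE cC.
case/andP => /and3P[_ aX eza] pth lst; case: (boolP (a \in C)) => aC.
  by exists z, a; split=> //; move: aX; rewrite !inE aC andbT => /andP[].
have aHC : a \in H :\: C by move: aX; rewrite !inE aC => /andP[_ ->].
have [d [w [dHC wC ad dw]]] := IHp a aHC pth lst.
exists d, w; split=> //; apply: connect_trans ad; apply: connect1.
by rewrite /induced /= zHC aHC.
Qed.

(** A path in [H :\ x] that is shortest among those joining two distinct neighbours of [x] is
    induced and has no inner neighbour of [x], so it closes through [x] to an induced cycle. *)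
Lemma biconnected_icyc H : 2 < #|H| -> biconnected e H ->
  exists n f, icyc n f /\ cset n f \subset H.
Proof.
move=> H2 /andP[conH /forallP ncut].
have [x xH] : exists x, x \in H by apply/card_gt0P; lia.
have nbr X c : gconnected e (H :\: X) -> x \notin X -> c \in H :\: X -> c != x ->
    exists2 w, w \in (H :\ x) :\: X & e x w.
  move=> /gconnectedP conX xX cX cx.
  have /connectP[[|w p] /=] := conX x c (etrans (in_setD _ _ _) (introT andP (conj xX xH))) cX.
    by move=> _ Dc; rewrite Dc eqxx in cx.
  case/andP=> /and3P[_ wX exw] _ _; exists w => //.
  move: wX; rewrite !inE => /andP[-> ->]; rewrite andbT.
  by apply: contraTneq exw => ->; rewrite e_irr.
have conv v : gconnected e (H :\ v).
  case: (boolP (v \in H)) => vH; first by have := ncut v; rewrite /cut_vertex vH negbK.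
  by have -> : H :\ v = H; [apply/setDidPl; rewrite disjoint_sym disjoints1 | ].
(* Connectedness of [H] gives one neighbour [y] of [x], that of [H :\ y] a second one. *)
have [y [y' [yH y'H nyy' exy exy']]] : exists y y',
    [/\ y \in H :\ x, y' \in H :\ x, y != y', e x y & e x y'].
  have [c] : exists c, c \in H :\ x.
    by apply/card_gt0P; have := cardsD1 x H; rewrite xH; lia.
  rewrite !inE => /andP[cx cH].
  have [||||y] := nbr set0 c; rewrite ?setD0 ?inE ?cH //.
  move=> yH' exy; have yH : y \in H :\ x by move: yH'; rewrite !inE.
  have [c'] : exists c', c' \in (H :\ x) :\ y.
    apply/card_gt0P; have := cardsD1 x H; have := cardsD1 y (H :\ x).
    by rewrite xH yH; lia.
  rewrite !inE => /and3P[cy' cx' cH'].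
  have [||||y'] := nbr [set y] c'; rewrite ?inE ?cy' ?cH' //.
    by move: yH; rewrite inE eq_sym; case/andP; rewrite inE.
  move=> /and3P[nyy' nxy' y'H] exy'.
  exists y, y'; split=> //; first by rewrite !inE nxy'.
  by rewrite eq_sym.
pose Q a b := [&& a != b, e x a & e x b].
have /gconnectedP/(_ y y' yH y'H) con := conv x.
have [|m [g [Qg gH cg minQ]]] := @shortest_path (H :\ x) Q y y' yH con; first by apply/and3P.
have m0 : 0 < m by case: m Qg {gH cg minQ} => //; rewrite /Q eqxx.
have gx i : i <= m -> g i != x /\ g i \in H by move/gH; rewrite !inE => /andP[].
exists m.+2, (fun i => if i is j.+1 then g j else x); split; last first.
  apply/subsetP => z /csetP[[|i] lti ->] //.
  by have [] := gx i _.
split=> // -[|i] [|j] // ltij; last first.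
  have [|-> ->] := cg i j; first by clear -ltij; lia.
  by split=> //; clear; lia.
split; first by rewrite eq_sym; have [] := gx j _.
rewrite orbC /=; case/and3P: Qg => g0m exg0 exgm.
apply/idP/idP => [exgj|]; last by case/orP => [/eqP|] => [[->]|/eqP[->]].
case: (posnP j) => [->|j0]; first by rewrite orbT.
have jm : 0 < j < m.+1 by rewrite j0.
have [n0j _] := cg 0 j jm; have Qj : Q (g 0) (g j) by apply/and3P.
by have [_ ->] := minQ 0 j (proj2 (andP jm)) Qj; rewrite eqxx.
Qed.

(** The arc [f 0], ..., [f a] is closed up by [g] run backwards, from [g m] at position [a.+1] to
    [g 0] at the last position. The bound [a.+1 < n] keeps the edge between [f n.-1] and [f 0] out
    of the arc. *)
Lemma icyc_detour n f m g a :
  icyc n f -> 0 < a -> a.+1 < n -> chordless m.+1 g ->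
  (forall i, i <= m -> g i \notin cset n f) ->
  (forall i x, i <= m -> x <= a ->
     e (g i) (f x) = (i == 0) && (x == 0) || (i == m) && (x == a)) ->
  icyc (a + m.+2) (fun i => if i <= a then f i else g (a + m.+1 - i)).
Proof.
move=> [n2 cf] a0 an cg gf adj; split=> [|i j ltij]; first nat_lia.
case: ifP => hi; case: ifP => hj; try nat_lia.
- by have [|-> ->] := cf i j; first nat_lia; split => //; nat_lia.
- split; last by rewrite e_sym adj; nat_lia.
  apply: contraNneq (gf (a + m.+1 - j) _) => [<-|]; last nat_lia.
  by apply: mem_cset; nat_lia.
- have [|H1 H2] := cg (a + m.+1 - j) (a + m.+1 - i); first nat_lia.
  by rewrite eq_sym H1 e_sym H2; split => //; nat_lia.
Qed.

Lemma cset_flip n f : cset n (flip n f) = cset n f.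
Proof.
apply/setP => x; apply/csetP/csetP => -[i lt_in ->]; rewrite /flip.
  by case: (posnP i) => [_|i0]; [exists 0 | exists (n - i)] => //; nat_lia.
case: (posnP i) => [->|i0]; first by exists 0 => //; nat_lia.
exists (n - i); first nat_lia.
by rewrite (_ : (n - i == 0) = false) ?subKn //; nat_lia.
Qed.

(** * Graphs whose induced cycles all have the same odd length *)

Section OddCycles.
Variable k : nat.
Hypotheses (k5 : 4 < k) (k_odd : odd k).
Hypothesis all_k : forall n f, icyc n f -> n = k.

Lemma triangle_free x y z : e x y -> e y z -> e x z -> False.
Proof.
move=> exy eyz exz; suff /all_k : icyc 3 (nth x [:: x; y; z]) by nat_lia.
split=> // i j ltij.
have neq u v : e u v -> u != v by apply: contraTneq => ->; rewrite e_irr.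
have : (i == 0) && (j == 1) || (i == 0) && (j == 2) || (i == 1) && (j == 2) by nat_lia.
by case/orP => [/orP[]|] /andP[/eqP-> /eqP->]; rewrite /= ?neq ?exy ?eyz ?exz.
Qed.

(** If [f b] is the first neighbour of [x] after [f 0], the arc up to [f b] closes through [x] to an
    induced cycle of length [b + 2]. Hence [b = k - 2], while [b <= a <= k - 2]. *)
Lemma far_nbrs_one f x a : icyc k f -> x \notin cset k f ->
  e x (f 0) -> e x (f a) -> 1 < a -> a.+1 < k -> a = k - 2.
Proof.
move=> cf xf ex0 exa a1 ak.
have exP : exists b, (0 < b) && e x (f b) by exists a; rewrite exa; nat_lia.
case: (ex_minnP exP) => b /andP[b0 exb] minb.
have ba : b <= a by apply: minb; rewrite exa; nat_lia.
suff : b + 2 = k by nat_lia.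
apply: (all_k (icyc_detour (m := 0) (g := fun=> x) cf b0 _ _ _ _)) => //; first nat_lia.
- by move=> i j; nat_lia.
- move=> i y i0 yb; have -> : i = 0 by nat_lia.
  case: (eqVneq y 0) => [->|y0]; first by rewrite ex0.
  case: (eqVneq y b) => [->|nyb]; first by rewrite exb.
  apply/negP => exy; have : b <= y by apply: minb; rewrite exy; nat_lia.
  nat_lia.
Qed.

(** An ear vertex sees at most one cycle vertex: two would either span a triangle with it or be far
    apart, against minimality. If an inner ear vertex sees [f x], then [x] is equal or next to both
    0 and [a] on the cycle; for [a != 2] the arc from 0 to [a] has no such [x], so it closes up with
    the ear. *)
Lemma far_nbrs_long f m g a : icyc k f -> 0 < m -> chordless m.+1 g ->
  (forall i, i <= m -> g i \notin cset k f) ->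
  1 < a -> a.+1 < k -> e (g 0) (f 0) -> e (g m) (f a) ->
  (forall i j x y, i <= m -> j <= m -> x < k -> y < k ->
     e (g i) (f x) -> e (g j) (f y) -> f x != f y -> ~~ e (f x) (f y) ->
     (i == 0) && (j == m) || (i == m) && (j == 0)) ->
  a != 2 -> a + m.+2 = k.
Proof.
move=> cf m0 cg gf a1 ak e00 ema far a2.
have [_ cf'] := cf.
have close i x b : i <= m -> x < k -> b < k -> e (g i) (f x) ->
    forall j, j <= m -> e (g j) (f b) -> ~~ ((i == 0) && (j == m) || (i == m) && (j == 0)) ->
    (x == b) || (x == b.+1) || (b == x.+1) || (x == 0) && (b == k.-1) || (x == k.-1) && (b == 0).
  move=> im xk bk ex j jm eb nij.
  case: (eqVneq (f x) (f b)) => [/(icyc_inj cf xk bk)|nxb]; first by nat_lia.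
  have := contraNN (far i j x b im jm xk bk ex eb nxb) nij; rewrite negbK => exb.
  case: (ltngtP x b) => // lt.
    by move: exb; have [|_ ->] := cf' x b; nat_lia.
  by move: exb; rewrite e_sym; have [|_ ->] := cf' b x; nat_lia.
have uniq_nbr i x b : i <= m -> x < k -> b < k -> e (g i) (f x) -> e (g i) (f b) -> x = b.
  move=> im xk bk ex eb; apply: (icyc_inj cf xk bk); apply/eqP/negP => /negP nxb.
  case: (boolP (e (f x) (f b))) => exb.
    exact: (triangle_free ex exb eb).
  by have := far i i x b im im xk bk ex eb nxb exb; nat_lia.
apply: (all_k (icyc_detour (g := g) cf _ _ cg gf _)); try nat_lia.
move=> i x im xa.
case: (eqVneq i 0) => [->|i0].
  case: (eqVneq x 0) => [->|x0]; first by rewrite e00.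
  transitivity false; last nat_lia.
  by apply/negP => ex; move: x0; rewrite (uniq_nbr 0 x 0) //; nat_lia.
case: (eqVneq i m) => [->|nim].
  case: (eqVneq x a) => [->|nxa]; first by rewrite ema.
  by apply/negP => ex; move: nxa; rewrite (uniq_nbr m x a) ?eqxx //; nat_lia.
apply/negP => ex.
have xk : x < k by nat_lia.
have xk0 : (x == 0) || (x == 1) || (x == k.-1).
  have k0 : 0 < k by nat_lia.
  have nij : ~~ ((i == 0) && (0 == m) || (i == m) && (0 == 0)) by nat_lia.
  by have := close i x 0 im xk k0 ex 0 isT e00 nij; clear - k5; nat_lia.
have nij : ~~ ((i == 0) && (m == m) || (i == m) && (m == 0)) by nat_lia.
have := close i x a im xk (ltnW ak) ex m (leqnn m) ema nij.
clear - xk0 a1 a2 ak k5 xa; nat_lia.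
Qed.

Lemma no_far_ear f m g a : icyc k f -> chordless m.+1 g ->
  (forall i, i <= m -> g i \notin cset k f) ->
  1 < a -> a.+1 < k -> e (g 0) (f 0) -> e (g m) (f a) ->
  (forall i j x y, i <= m -> j <= m -> x < k -> y < k ->
     e (g i) (f x) -> e (g j) (f y) -> f x != f y -> ~~ e (f x) (f y) ->
     (i == 0) && (j == m) || (i == m) && (j == 0)) ->
  False.
Proof.
move=> cf cg gf a1 ak e00 ema far.
have cf' := icyc_flip cf.
have fa : flip k f (k - a) = f a by rewrite /flip (_ : (k - a == 0) = false) ?subKn //; nat_lia.
case: (posnP m) => [m0|m0].
  (* Read in both directions, the cycle gives [a = k - 2] and [k - a = k - 2], whence [k = 4]. *)
  subst m; have a2 := far_nbrs_one cf (gf 0 isT) e00 ema a1 ak.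
  have := @far_nbrs_one (flip k f) (g 0) (k - a) cf'.
  by rewrite cset_flip fa => /(_ (gf 0 isT) e00 ema); nat_lia.
have len1 := far_nbrs_long cf m0 cg gf a1 ak e00 ema far.
(* The other arc is the arc from 0 to [k - a] of the reversed cycle. *)
have len2 : k - a != 2 -> k - a + m.+2 = k.
  apply: (@far_nbrs_long (flip k f) m g (k - a) cf' m0 cg); rewrite ?cset_flip ?fa //; try nat_lia.
  have flipk x : x < k -> exists2 x', x' < k & flip k f x = f x'.
    by move=> xk; apply/csetP; rewrite -cset_flip mem_cset.
  move=> i j x y im jm /flipk[x' xk ->] /flipk[y' yk ->].
  exact: far.
(* If one arc has two edges, closing the other, of [k - 2] edges, gives [k + m = k]. Otherwise the
   arcs are equally long and [k] is even. *)
case: (eqVneq a 2) => [a2|/len1 L1]; first by have := len2; nat_lia.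
case: (eqVneq (k - a) 2) => [|/len2]; nat_lia.
Qed.

Lemma biconnected_odd_cycle H : biconnected e H -> 2 < #|H| ->
  (forall u v, ~~ separating_edge e H u v) -> is_Ck e k H.
Proof.
move=> biH H2 nsep; have [conH /forallP ncut] := andP biH.
have [n [f [cf sfH]]] := biconnected_icyc H2 biH.
have Dn := all_k cf; subst n; set C := cset k f in sfH.
have fC i : i < k -> f i \in C by apply: mem_cset.
case: (boolP (H \subset C)) => [HC|/subsetPn[z zH zC]].
  exists (mkseq f k); rewrite size_mkseq; split=> //; first exact: icyc_seq.
  have -> : H = C by apply/eqP; rewrite eqEsubset HC.
  apply/setP => x; rewrite inE; apply/csetP/mapP => -[i ik ->]; exists i => //.
    by rewrite mem_iota.
  by move: ik; rewrite mem_iota.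
have zHC : z \in H :\: C by rewrite inE zC.
(* The component of [z] in [H :\: C] sees the cycle vertex [w]. *)
pose attach w := exists d, [/\ d \in H :\: C, w \in C,
  connect (induced e (H :\: C)) z d & e d w].
have exit X : gconnected e (H :\: X) -> X \subset C -> #|X| <= 2 ->
    exists2 w, attach w & w \notin X.
  move=> conX XC X2; have /subsetPn[c cC cX] : ~~ (C \subset X).
    apply/negP => /subset_leq_card; rewrite card_cset //; nat_lia.
  have cHCX : c \in (H :&: C) :\: X by rewrite !inE cX cC (subsetP sfH).
  have [d [w [dHC]]] := gconnected_exit conX XC zHC cHCX.
  by rewrite inE => /andP[wX wC] zd dw; exists w => //; exists d.
(* [exit] is applied to the empty set, a vertex and an edge in turn; three pairwise adjacent
   attachments would form a triangle. *)
have [u [v [[d [dHC uC zd du]] [d' [d'HC vC zd' d'v]] nuv euv]]] :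
    exists u v, [/\ attach u, attach v, u != v & ~~ e u v].
  have [||u ua _] := exit set0 _ (sub0set _); rewrite ?setD0 ?cards0 //.
  have uC : u \in C by case: ua => d [].
  have uH : u \in H := subsetP sfH _ uC.
  have [|||v va] := exit [set u]; rewrite ?sub1set ?cards1 //.
    by have := ncut u; rewrite /cut_vertex uH negbK.
  rewrite inE => nvu; have vC : v \in C by case: va => d [].
  case: (boolP (e u v)) => euv; last by exists u, v; rewrite eq_sym.
  have [|||w wa] := exit [set u; v]; rewrite ?cards2 ?subUset ?sub1set ?uC ?vC //.
  - by have := nsep u v; rewrite /separating_edge uH (subsetP sfH v vC) euv negbK.
  - by case: (_ != _).
  rewrite !inE negb_or => /andP[nwu nwv].
  case: (boolP (e u w)) => euw; last by exists u, w; rewrite eq_sym.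
  case: (boolP (e v w)) => evw; last by exists v, w; rewrite eq_sym.
  by case: (triangle_free euv evw euw).
(* [Q] describes the ends of an ear with far attachments. The minimal ear may attach elsewhere than
   at [u] and [v], so these are later replaced by its own attachments. *)
pose Q (a b : T) := [exists u in C, [exists v in C, [&& u != v, ~~ e u v, e a u & e b v]]].
have QP a b s t : s \in C -> t \in C -> s != t -> ~~ e s t -> e a s -> e b t -> Q a b.
  move=> sC tC nst est eas ebt; apply/exists_inP; exists s => //.
  by apply/exists_inP; exists t => //; apply/and4P.
have con : connect (induced e (H :\: C)) d d'.
  by apply: connect_trans zd'; rewrite induced_sym.
have [m [g [Qg gHC cg minQ]]] := shortest_path dHC con (QP d d' u v uC vC nuv euv du d'v).
case/exists_inP: Qg => {d dHC zd du d' d'HC zd' d'v con uC v vC nuv euv} {}u uC.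
case/exists_inP => v vC /and4P[nuv euv e0u emv].
have /csetP[i0 i0k Du] := uC.
have [f' [cf' Df0 Cf']] := icyc_rot cf i0k; have [_ adj] := cf'.
have /csetP[a ak Dv] : v \in cset k f' by rewrite Cf'.
have {}Du : u = f' 0 by rewrite Df0.
have a0 : 0 < a by rewrite lt0n; apply: contraNneq nuv => a0; rewrite Du Dv a0.
have [|_ Ea] := adj 0 a; first by rewrite a0.
rewrite Du Dv Ea in euv.
have gC i : i <= m -> g i \notin cset k f' by move/gHC; rewrite Cf' inE => /andP[].
have fC' x : x < k -> f' x \in C by move=> xk; rewrite /C -Cf' mem_cset.
apply: False_ind; apply: (no_far_ear (a := a) cf' cg gC); rewrite -?Du -?Dv //; try nat_lia.
move=> i j x y im jm xk yk exi eyj nxy exy; case: (leqP i j) => ij.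
  have [||-> ->] := minQ i j; last by rewrite !eqxx.
    by rewrite ij.
  by apply: (QP _ _ (f' x) (f' y)); rewrite ?fC'.
have [||-> ->] := minQ j i; last by rewrite !eqxx orbT.
  by rewrite ltnW.
by apply: (QP _ _ (f' y) (f' x)); rewrite ?fC' 1?eq_sym // e_sym.
Qed.

End OddCycles.

(** * Biconnected sets, clique deletion and nested induced cycles *)

Lemma exists_third A x y : 2 < #|A| -> exists2 z, z \in A & z \notin [set x; y].
Proof.
move=> A2; apply/subsetPn; apply: contraL A2 => /subset_leq_card.
by rewrite cards2 -leqNgt => /leq_trans -> //; case: (_ != _).
Qed.

Lemma connect_inducedS A B x y : A \subset B ->
  connect (induced e A) x y -> connect (induced e B) x y.
Proof.
move=> /subsetP AB; apply: connect_sub => {}x {}y /and3P[xA yA exy].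
by apply: connect1; rewrite /induced /= !AB.
Qed.

(** Any two vertices are already joined after deletion of a third one. *)
Lemma no_cut_biconnected A : 2 < #|A| -> [forall v, ~~ cut_vertex e A v] ->
  biconnected e A.
Proof.
move=> A2 ncut; rewrite /biconnected ncut andbT; apply/gconnectedP => x y xA yA.
have [w wA] := exists_third x y A2; rewrite !inE negb_or => /andP[wx wy].
have := forallP ncut w; rewrite /cut_vertex wA negbK => /gconnectedP conA.
by apply: connect_inducedS (conA x y _ _); rewrite ?subD1set // !inE eq_sym ?wx ?wy.
Qed.

Lemma biconnected_K2 A : #|A| = 2 -> gconnected e A -> is_K2 e A.
Proof.
move=> /eqP/cards2P[x [y [nxy ->]]] /gconnectedP/(_ x y); rewrite !inE !eqxx orbT.
case/(_ isT isT)/connectP => -[|a p] /=; first by move=> _ Dy; rewrite Dy eqxx in nxy.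
case/andP=> /and3P[_ aA exa] _ _; exists x, y; split=> //.
by move: aA exa; rewrite !inE => /orP[]/eqP -> //; rewrite e_irr.
Qed.

(** The cycle is numbered from a vertex of [X], if it has one. Any other deleted position is then 1
    or [n.-1], so the surviving positions form an interval and are joined along it. *)
Lemma icyc_minus_clique n f X : icyc n f ->
  {in X &, forall u v, u != v -> e u v} -> gconnected e (cset n f :\: X).
Proof.
move=> cf clX.
have [g [cg <- convex]] : exists g, [/\ icyc n g, cset n g = cset n f &
    forall i l j, i < l < j -> j < n -> g i \notin X -> g j \notin X -> g l \notin X].
  case: (boolP [disjoint cset n f & X]) => [dis|].
    exists f; split=> // i l j ilj jn _ _.
    by rewrite (disjointFr dis) // mem_cset //; nat_lia.
  case/pred0Pn => u /andP[/csetP[t tn ->] ftX].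
  have [g [cg g0 Cg]] := icyc_rot cf tn; exists g; split=> // i l j ilj jn giX gjX.
  apply/negP => glX; have [_ cg'] := cg.
  have i0 : 0 < i by rewrite lt0n; apply: contraNneq giX => ->; rewrite g0.
  have [|ng0l eg0l] := cg' 0 l; first nat_lia.
  have : e (g 0) (g l) by apply: clX; rewrite ?g0 // -g0.
  by rewrite eg0l; nat_lia.
have con i d : i + d < n -> g i \notin X -> g (i + d) \notin X ->
    connect (induced e (cset n g :\: X)) (g i) (g (i + d)).
  elim: d => [|d IHd] idn giX gX; first by rewrite addn0.
  have gdX : g (i + d) \notin X.
    case: (posnP d) => [->|d0]; first by rewrite addn0.
    by apply: (convex i _ (i + d.+1)) => //; nat_lia.
  apply: connect_trans (IHd _ giX gdX) (connect1 _); first nat_lia.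
  rewrite addnS /induced /= !in_setD -addnS gX gdX !mem_cset; try nat_lia.
  by rewrite addnS (icyc_next cg) // -addnS.
apply/gconnectedP => x y /setDP[/csetP[i lti ->] xX] /setDP[/csetP[j ltj ->] yX].
case: (leqP i j) => ij; first by have := con i (j - i); rewrite subnKC //; apply.
by rewrite induced_sym //; have := con j (i - j); rewrite subnKC; [apply | apply: ltnW].
Qed.

(** Number the larger cycle from a vertex missing in the smaller. The vertex of the smaller cycle at
    the least position [s] can only have [g' s.+1] as a neighbour there, yet it needs two. *)
Lemma icyc_sub n k f g : icyc n f -> icyc k g -> cset n f \subset cset k g -> n = k.
Proof.
move=> cf cg sfg; case: (boolP (cset k g \subset cset n f)) => [sgf|].
  by rewrite -(card_cset cf) -(card_cset cg); apply/eqP; rewrite eqn_leq !subset_leq_card.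
case/subsetPn => w /csetP[t tk ->] gtf.
have [g' [cg' g'0 Cg']] := icyc_rot cg tk; rewrite -Cg' in sfg; rewrite -g'0 in gtf.
have [_ adj] := cg'; have [n2 _] := cf.
have : f 0 \in cset k g' by apply: (subsetP sfg); apply: mem_cset; nat_lia.
case/csetP => s0 s0k Df0.
have exP : exists s, (s < k) && (g' s \in cset n f).
  by exists s0; rewrite s0k -Df0 mem_cset //; nat_lia.
case: (ex_minnP exP) => s /andP[sk gsf] mins.
have s_gt0 : 0 < s by rewrite lt0n; apply: contraNneq gtf => <-.
have [y [z [yf zf nyz ey ez]]] := icyc_nbrs cf gsf.
have up x : x \in cset n f -> e (g' s) x -> x = g' s.+1.
  move=> xf; have /csetP[i ik Dx] := subsetP sfg x xf; rewrite Dx in xf *.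
  have := mins i; rewrite ik xf => /(_ isT); case: (ltngtP s i) => // [si _|-> _].
    have [|_ ->] := adj s i; first by rewrite si.
    by case/orP => [/eqP -> //|]; nat_lia.
  by rewrite e_irr.
by rewrite (up y) // (up z) // eqxx in nyz.
Qed.

Lemma icyc_biconnected n f : icyc n f -> biconnected e (cset n f).
Proof.
move=> cf; apply: no_cut_biconnected; first by rewrite card_cset //; case: cf.
apply/forallP => v; rewrite negb_and negbK icyc_minus_clique ?orbT //.
by move=> x y; rewrite !inE => /eqP-> /eqP->; rewrite eqxx.
Qed.

(** * Invariants of the splitting process *)

Lemma decomposition_ind (I : {set {set T}} -> Prop) :
  I (blocks e) -> (forall P Q, split_step e P Q -> I P -> I Q) ->
  forall P, clique_decomposition e P -> I P.
Proof.
move=> Ib IS P /andP[/connectP[p]].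
elim: p (blocks e) Ib => [|R p IHp] B IB /=; first by move=> _ ->.
by case/andP=> /IS/(_ IB) IR pth lst; apply: (IHp R).
Qed.

Lemma split_stepP (P Q : {set {set T}}) : reflect
  (exists H u v, [/\ H \in P, separating_edge e H u v & Q = (P :\ H) :|: split_along e H u v])
  (split_step e P Q).
Proof.
apply: (iffP exists_inP) => [[H HP /existsP[u /existsP[v /andP[sep /eqP DQ]]]]|].
  by exists H, u, v.
case=> H [u [v [HP sep DQ]]]; exists H => //; apply/existsP; exists u.
by apply/existsP; exists v; rewrite sep DQ eqxx.
Qed.

(** The cycle is biconnected, so it starts inside a block. Deleting a separating edge leaves it
    connected, so what remains lies in a single component. *)
Lemma icyc_in_piece n f (P : {set {set T}}) : icyc n f -> clique_decomposition e P ->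
  exists2 A, A \in P & cset n f \subset A.
Proof.
move=> cf; have [n2 _] := cf; move: P.
apply: decomposition_ind => [|P Q /split_stepP[H [u [v [HP sep ->]]]] [A AP sfA]].
  have : [pred B : {set T} | (1 < #|B|) && biconnected e B] (cset n f).
    by rewrite /= icyc_biconnected // card_cset // ltnW.
  by case/maxset_exists => A maxA sfA; exists A; rewrite // inE.
case: (eqVneq A H) => [DA|nAH]; last by exists A; rewrite // !inE nAH AP.
rewrite DA in sfA; have [_ _ euv _] := and4P sep.
have [x xf xuv] : exists2 x, x \in cset n f & x \notin [set u; v].
  by apply: exists_third; rewrite card_cset.
have xH : x \in H :\: [set u; v] by rewrite inE xuv (subsetP sfA).
set K := H :\: [set u; v] in xH.
have xC := imset_f (fun x => [set y in K | connect (induced e K) x y]) xH.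
have /gconnectedP con : gconnected e (cset n f :\: [set u; v]).
  apply: icyc_minus_clique cf _ => a b; rewrite !inE.
  by case/orP=> /eqP->; case/orP=> /eqP->; rewrite ?eqxx // e_sym.
eexists; first by rewrite inE; apply/orP; right; apply: imset_f xC.
apply/subsetP => y yf; rewrite in_setU; case: (boolP (y \in [set u; v])) => yuv.
  by rewrite orbT.
rewrite orbF inE in_setD yuv (subsetP sfA) //=.
by apply: connect_inducedS (setSD _ sfA) (con _ _ _ _); rewrite in_setD ?xuv ?yuv.
Qed.

(** A new piece contains both ends of the separating edge and a further vertex, so the absence of
    cut vertices, from [split_no_cut], also yields connectedness. *)
Lemma piece_biconnected (P : {set {set T}}) : clique_decomposition e P ->
  forall A, A \in P -> 1 < #|A| /\ biconnected e A.
Proof.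
move: P; apply: decomposition_ind.
  by move=> A; rewrite inE => /maxsetp/andP.
move=> P Q /split_stepP[H [u [v [HP sep ->]]]] IP A; rewrite in_setU.
case/orP=> [/setD1P[_ AP]|/imsetP[C Ccomp ->]]; first exact: IP.
have [_ _ euv _] := and4P sep.
have nuv : u != v by apply: contraTneq euv => ->; rewrite e_irr.
have card3 : 2 < #|C :|: [set u; v]|.
  have : [set u; v] \proper C :|: [set u; v].
    have [x xH DC] := imsetP Ccomp.
    rewrite properE subsetUr /=; apply/subsetPn; exists x.
      by rewrite DC !inE connect0; move: xH; rewrite !inE => ->.
    by move: xH; rewrite !inE => /andP[].
  by move/proper_card; rewrite cards2 nuv.
split; first exact: ltnW.
apply: no_cut_biconnected => //; apply/forallP => w.
have [_ /andP[_ ncut]] := IP H HP.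
exact: split_no_cut e_sym _ _ _ _ w nuv ncut sep Ccomp.
Qed.

End InducedCycles.

Theorem theorem5 (T : finType) (e : rel T) (m k : nat) (P : {set {set T}}) :
  symmetric e -> irreflexive e -> 0 < m -> k = 2 * m + 3 ->
  gconnected e [set: T] -> clique_decomposition e P ->
  (SC e k <-> forall A : {set T}, A \in P -> is_K2 e A \/ is_Ck e k A).
Proof.
move=> e_sym e_irr m0 Dk _ decP; split=> [SCk A AP|pieces].
  have all_k n f : icyc e n f -> n = k.
    move=> /(icyc_seq e_sym e_irr) cyc; rewrite -(size_mkseq f n).
    case: SCk => [ncyc|]; last exact.
    by case/andP: cyc => /idPn; rewrite ncyc.
  have [A1 biA] := piece_biconnected e_sym e_irr decP AP.
  have [/eqP|A2] := leqP #|A| 2.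
    by left; apply: biconnected_K2 => //; [lia | case/andP: biA].
  right; apply: biconnected_odd_cycle => //; try lia.
  move=> u v; case/andP: decP => _ /forall_inP/(_ A AP)/andP[_ /forallP/(_ u)].
  by move/forallP.
(* The right disjunct of [SC] also covers acyclic graphs, where it is vacuous. *)
right=> c cyc; have n2 : 2 < size c by case/andP: cyc => /andP[].
case: c n2 cyc => // x0 c' _; set c := x0 :: c' => cyc.
have cf := seq_icyc e_sym x0 cyc.
have [A AP sfA] := icyc_in_piece e_sym cf decP.
have := subset_leq_card sfA; rewrite (card_cset cf).
case: (pieces A AP) => [[u [v [_ ->]]]|[d [dcyc Dd DA]]].
  rewrite cards2 leqNgt; case: cf => n2 _; case/negP; apply: leq_ltn_trans n2.
  by case: (u != v).
move=> _; rewrite -Dd; apply: (icyc_sub e_sym e_irr cf (seq_icyc e_sym x0 dcyc)).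
apply: subset_trans sfA _; rewrite DA; apply/subsetP => x; rewrite inE => xd.
by apply/csetP; exists (index x d); rewrite ?index_mem ?nth_index.
Qed.
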